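(* Let $\mu$ and $\lambda$ be two complex parameters. Then for all integers $n\ge1$, $$\begin{aligned}\sum_{k=0}^n\binom{n}{k}\left\lfloor\frac{k}{2}\right\rfloor\mu^k\lambda^{n-k}H_k&=\frac{n\mu}{2}(\lambda+\mu)^{n-1}H_n-\frac14\left((\lambda+\mu)^n-(\lambda-\mu)^n\right)H_n\\&\quad-\frac{\mu}{4}\sum_{k=0}^{n-1}\left((\lambda+\mu)^k-(\lambda-\mu)^k\right)\lambda^{n-1-k}H_{n-1-k}\\&\quad-\frac{\mu^2}{2}\sum_{k=0}^{n-2}(k+1)(\lambda+\mu)^k\lambda^{n-2-k}H_{n-2-k}.\end{aligned}$$
   Context: $\lfloor x\rfloor$ denotes the floor function. $H_n$ are the harmonic numbers: $H_0=0$ and $H_n=\sum_{k=1}^n\frac1k$ for $n\ge1$. Conventions: $0^0=1$, and $\sum_{k=m}^n s_k=0$ if $n<m$. *)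

(* Defs.v *)
From mathcomp Require Import all_boot all_order all_algebra.

Set Implicit Arguments.
Unset Strict Implicit.
Unset Printing Implicit Defensive.

Import GRing.Theory.
Local Open Scope ring_scope.

Definition harmonic_number (F : fieldType) (n : nat) : F :=
  \sum_(1 <= k < n.+1) k%:R^-1.
Arguments harmonic_number {F} n.

(* Main.v *)
Require Import Defs.
From mathcomp Require Import all_boot all_order all_algebra.
From mathcomp Require Import reals complex.
From mathcomp Require Import ring.

Set Implicit Arguments.
Unset Strict Implicit.
Unset Printing Implicit Defensive.

Import GRing.Theory.
Local Open Scope ring_scope.
Local Open Scope complex_scope.

(** Since [4 * floor (k / 2) = 2 * k - 1 + (-1) ^ k], the sum on the left is a
    combination of three sums without a floor. Let
    [S x = \sum_k 'C(n, k) x ^ k lambda ^ (n - k) H_k] be the binomial transform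
    of the harmonic numbers; then the left-hand side is
    [mu * S' mu / 2 - (S mu - S (- mu)) / 4].

    Pascal's rule turns [H_{k+1} = H_k + 1 / (k + 1)] into a first-order
    recurrence in [n] for [S], whose solution is
    [S x = ((lambda + x) ^ n - lambda ^ n) H_n
           - x \sum_(k < n) (lambda + x) ^ k lambda ^ (n-1-k) H_{n-1-k}]
    ([binomial_harmonic_sum]). This holds in every commutative ring containing
    the harmonic numbers, in particular for a polynomial indeterminate [x], so
    that it can be differentiated formally; this gives [x * S' x]
    ([weighted_binomial_harmonic_sum]). In the combination above the terms in
    [lambda ^ n H_n] cancel, the sum coming from the product rule contributes
    [- mu / 2 (lambda + mu) ^ k], and together with
    [mu / 4 ((lambda + mu) ^ k + (lambda - mu) ^ k)] this leaves the
    difference [- mu / 4 ((lambda + mu) ^ k - (lambda - mu) ^ k)]. *)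

(** Phrasing the defining recurrence without inverses lets the same results
    apply both to a field and to its polynomial ring. *)
Definition harmonic (A : comNzRingType) (h : nat -> A) :=
  h 0%N = 0 /\ forall n, n.+1%:R * (h n.+1 - h n) = 1.

Lemma harmonic_number_harmonic (F : numFieldType) :
  harmonic (@harmonic_number F).
Proof.
split=> [|n]; first by rewrite /harmonic_number big_geq.
rewrite {1}/harmonic_number big_nat_recr //= -/(harmonic_number n).
by rewrite addrAC subrr add0r mulfV // Num.Theory.pnatr_eq0.
Qed.

Lemma harmonic_polyC (A : comNzRingType) (h : nat -> A) :
  harmonic h -> harmonic (fun k => (h k)%:P).
Proof.
case=> h0 hS; split=> [|n]; first by rewrite h0.
by rewrite -polyCB -polyC_natr -polyCM hS.
Qed.

(** The absorption identity [(k+1) 'C(n+1, k+1) = (n+1) 'C(n, k)], divided by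
    [(k+1)(n+1)]. *)
Lemma harmonic_absorption (A : comNzRingType) (h : nat -> A) (n k : nat) :
  harmonic h ->
  'C(n, k)%:R * (h k.+1 - h k) = 'C(n.+1, k.+1)%:R * (h n.+1 - h n).
Proof.
case=> _ hS; have e : n.+1%:R * 'C(n, k)%:R = k.+1%:R * 'C(n.+1, k.+1)%:R :> A.
  by rewrite -!natrM mul_bin_diag.
transitivity ((n.+1%:R * 'C(n, k)%:R) * (h n.+1 - h n) * (h k.+1 - h k)).
  by rewrite (mulrAC n.+1%:R) hS mul1r.
by rewrite e mulrAC -mulrA mulrACA hS mul1r.
Qed.

Lemma binomial_sum (A : comNzRingType) (x y : A) (n : nat) :
  \sum_(0 <= k < n.+1) 'C(n, k)%:R * x ^+ k * y ^+ (n - k) = (y + x) ^+ n.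
Proof.
rewrite exprDn big_mkord; apply: eq_bigr => k _.
by rewrite -mulr_natl; ring.
Qed.

(** Pascal's rule at the level of sums: the two binomials that add up to
    ['C(n.+1, k)] contribute the factors [y] and [x], and the second one shifts
    the index of [f]. *)
Lemma binomial_transformS (A : comNzRingType) (x y : A) (f : nat -> A) n :
  \sum_(0 <= k < n.+2) 'C(n.+1, k)%:R * x ^+ k * y ^+ (n.+1 - k) * f k
  = y * (\sum_(0 <= k < n.+1) 'C(n, k)%:R * x ^+ k * y ^+ (n - k) * f k)
    + x * (\sum_(0 <= k < n.+1) 'C(n, k)%:R * x ^+ k * y ^+ (n - k) * f k.+1).
Proof.
rewrite big_nat_recl // !big_distrr /=.
rewrite (eq_bigr (fun k => 'C(n, k.+1)%:R * x ^+ k.+1 * y ^+ (n - k) * f k.+1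
   + x * ('C(n, k)%:R * x ^+ k * y ^+ (n - k) * f k.+1))); last first.
  by move=> k _; rewrite binS natrD subSS exprS; ring.
rewrite big_split /= addrA; congr (_ + _).
rewrite [in RHS]big_nat_recl // big_nat_recr //=.
rewrite (bin_small (ltnSn n)) !mul0r addr0.
congr (_ + _); first by rewrite !bin0 !subn0 exprS; ring.
rewrite !big_nat; apply: eq_bigr => k /andP[_ ltkn].
by rewrite -(subnSK ltkn) [y ^+ _.+1]exprS; ring.
Qed.

(** Pascal's rule leaves the transform of the increments [1 / (k+1)], which by
    absorption is the binomial expansion of [(y + x) ^ (n+1)] without its term
    of degree [0], divided by [n + 1]; the factor [h n.+1 - h n] is
    [1 / (n + 1)]. *)
Lemma binomial_harmonic_sumS (A : comNzRingType) (h : nat -> A) (x y : A) n :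
  harmonic h ->
  \sum_(0 <= k < n.+2) 'C(n.+1, k)%:R * x ^+ k * y ^+ (n.+1 - k) * h k
  = (y + x) * (\sum_(0 <= k < n.+1) 'C(n, k)%:R * x ^+ k * y ^+ (n - k) * h k)
    + ((y + x) ^+ n.+1 - y ^+ n.+1) * (h n.+1 - h n).
Proof.
move=> hh; rewrite binomial_transformS mulrDl -addrA; congr (_ + _).
rewrite -(binomial_sum x y n.+1) [X in X - _]big_nat_recl //=.
rewrite bin0 expr0 subn0 !mul1r.
rewrite [y ^+ _ + _]addrC addrK big_distrl !big_distrr -big_split /=.
apply: eq_bigr => k _.
have := harmonic_absorption n k hh.
rewrite subSS exprS => e.
transitivity (x * ('C(n, k)%:R * x ^+ k * y ^+ (n - k) * h k)
  + x * x ^+ k * y ^+ (n - k) * ('C(n, k)%:R * (h k.+1 - h k))); first by ring.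
by rewrite e; ring.
Qed.

Lemma convolutionS (A : comNzRingType) (f : nat -> A) (a : A) n :
  \sum_(0 <= k < n.+1) a ^+ k * f (n.+1 - 1 - k)%N
  = f n + a * \sum_(0 <= k < n) a ^+ k * f (n - 1 - k)%N.
Proof.
rewrite big_nat_recl //= subn1 subn0 /= expr0 mul1r big_distrr /=.
congr (_ + _).
by apply: eq_bigr => k _; rewrite exprS mulrA -subnDA add1n.
Qed.

(** Both sides satisfy the recurrence [binomial_harmonic_sumS]; on the right
    the terms in [y ^+ n * h n] balance because [(y + x) - y - x = 0]. *)
Lemma binomial_harmonic_sum (A : comNzRingType) (h : nat -> A) (x y : A) n :
  harmonic h ->
  \sum_(0 <= k < n.+1) 'C(n, k)%:R * x ^+ k * y ^+ (n - k) * h k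
  = ((y + x) ^+ n - y ^+ n) * h n
    - x * \sum_(0 <= k < n)
        (y + x) ^+ k * (y ^+ (n - 1 - k) * h (n - 1 - k)%N).
Proof.
move=> hh; elim: n => [|n IHn].
  by rewrite big_nat1 big_geq // (proj1 hh) !mulr0 subr0.
rewrite binomial_harmonic_sumS // IHn.
rewrite (convolutionS (fun j => y ^+ j * h j)) !exprS.
by ring.
Qed.

(** [binomial_harmonic_sum] for the indeterminate ['X], differentiated,
    evaluated at [x] and multiplied by [x]: on the left the Euler operator
    [x d/dx] brings down the factor [k]. *)
Lemma weighted_binomial_harmonic_sum (A : comNzRingType) (h : nat -> A)
    (x y : A) n :
  harmonic h ->
  \sum_(0 <= k < n.+1) 'C(n, k)%:R * k%:R * x ^+ k * y ^+ (n - k) * h k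
  = n%:R * x * (y + x) ^+ (n - 1) * h n
    - x * (\sum_(0 <= k < n)
        (y + x) ^+ k * (y ^+ (n - 1 - k) * h (n - 1 - k)%N))
    - x ^+ 2 * \sum_(0 <= k < n - 1)
        (k + 1)%:R * (y + x) ^+ k * y ^+ (n - 2 - k) * h (n - 2 - k)%N.
Proof.
move=> hh.
have derivXk (k : nat) (c : A) :
    ('X^k * c%:P)^`().[x] = k%:R * x ^+ k.-1 * c.
  by rewrite derivM derivC mulr0 addr0 derivXn !hornerE hornerMn hornerXn
             mulr_natl.
have derivDk (k : nat) (c : A) :
    ((y%:P + 'X) ^+ k * c%:P)^`().[x] = k%:R * (y + x) ^+ k.-1 * c.
  rewrite derivM derivC mulr0 addr0 deriv_exp derivD derivC derivX add0r mul1r.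
  by rewrite hornerM hornerMn horner_exp !hornerE mulr_natl.
have evalDk (k : nat) (c : A) :
    ((y%:P + 'X) ^+ k * c%:P).[x] = (y + x) ^+ k * c.
  by rewrite hornerM horner_exp !hornerE.
have := binomial_harmonic_sum 'X y%:P n (harmonic_polyC hh).
move/(congr1 (fun p : {poly A} => x * p^`().[x])).
rewrite raddf_sum horner_sum big_distrr /= => eL.
transitivity (\sum_(0 <= k < n.+1)
  x * ('C(n, k)%:R * 'X^k * y%:P ^+ (n - k) * (h k)%:P)^`().[x]).
  apply: eq_bigr => k _.
  have -> : 'C(n, k)%:R * 'X^k * y%:P ^+ (n - k) * (h k)%:P
      = 'X^k * ('C(n, k)%:R * y ^+ (n - k) * h k)%:P.
    by rewrite !polyCM polyC_natr polyC_exp; ring.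
  rewrite derivXk; case: k => [|k]; first by rewrite !(mul0r, mulr0).
  by rewrite exprS /=; ring.
rewrite eL -polyC_exp.
have -> : ((y%:P + 'X) ^+ n - (y ^+ n)%:P) * (h n)%:P
   = (y%:P + 'X) ^+ n * (h n)%:P - (y ^+ n * h n)%:P by rewrite polyCM; ring.
rewrite !(derivB, derivM 'X, derivX, derivC) subr0 mul1r.
rewrite hornerD hornerN hornerD hornerM hornerX derivDk.
under eq_bigr => k _ do rewrite -polyC_exp -polyCM.
rewrite raddf_sum /= !horner_sum.
rewrite (eq_bigr _ (fun k _ => evalDk k _)).
rewrite (eq_bigr _ (fun k _ => derivDk k _)).
have -> : \sum_(0 <= k < n)
     k%:R * (y + x) ^+ k.-1 * (y ^+ (n - 1 - k) * h (n - 1 - k)%N)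
   = \sum_(0 <= k < n - 1)
        (k + 1)%:R * (y + x) ^+ k * y ^+ (n - 2 - k) * h (n - 2 - k)%N.
  case: n {eL} => [|n]; first by rewrite !big_geq.
  (* The constant term disappears under differentiation. *)
  rewrite big_nat_recl // !mul0r add0r subn1 /=.
  by apply: eq_bigr => k _; rewrite addn1 mulrA subSS -subnDA add1n.
by rewrite subn1; ring.
Qed.

Lemma half_signE (A : comNzRingType) (k : nat) :
  4 * (k %/ 2)%:R = 2 * k%:R - 1 + (-1) ^+ k :> A.
Proof.
rewrite -signr_odd -[in k%:R](odd_double_half k) divn2 natrD -mul2n natrM.
by case: (odd k) => /=; ring.
Qed.

Lemma binomial_half_harmonic_sum (F : numFieldType) (mu lambda : F) (n : nat) :
  \sum_(0 <= k < n.+1)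
      'C(n, k)%:R * (k %/ 2)%:R * mu ^+ k * lambda ^+ (n - k) * harmonic_number k
  = n%:R * mu / 2 * (lambda + mu) ^+ (n - 1) * harmonic_number n
    - 1 / 4 * ((lambda + mu) ^+ n - (lambda - mu) ^+ n) * harmonic_number n
    - mu / 4 * \sum_(0 <= k < n)
        ((lambda + mu) ^+ k - (lambda - mu) ^+ k)
          * lambda ^+ (n - 1 - k) * harmonic_number (n - 1 - k)
    - mu ^+ 2 / 2 * \sum_(0 <= k < n - 1)
        (k + 1)%:R * (lambda + mu) ^+ k
          * lambda ^+ (n - 2 - k) * harmonic_number (n - 2 - k).
Proof.
have hh := harmonic_number_harmonic F.
have eW := weighted_binomial_harmonic_sum mu lambda n hh.
have eP := binomial_harmonic_sum mu lambda n hh.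
have eN := binomial_harmonic_sum (- mu) lambda n hh.
have -> : \sum_(0 <= k < n.+1) 'C(n, k)%:R * (k %/ 2)%:R * mu ^+ k
      * lambda ^+ (n - k) * harmonic_number k
  = 1 / 2 * (\sum_(0 <= k < n.+1) 'C(n, k)%:R * k%:R * mu ^+ k
      * lambda ^+ (n - k) * harmonic_number k)
    - 1 / 4 * (\sum_(0 <= k < n.+1) 'C(n, k)%:R * mu ^+ k
      * lambda ^+ (n - k) * harmonic_number k)
    + 1 / 4 * (\sum_(0 <= k < n.+1) 'C(n, k)%:R * (- mu) ^+ k
      * lambda ^+ (n - k) * harmonic_number k).
  rewrite !big_distrr -sumrB -big_split /=; apply: eq_bigr => k _.
  have -> : (k %/ 2)%:R = (2 * k%:R - 1 + (-1) ^+ k) / 4 :> F.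
    by rewrite -half_signE mulrC mulKf // Num.Theory.pnatr_eq0.
  by rewrite (exprNn mu); field.
rewrite eW eP eN.
have -> : \sum_(0 <= k < n) ((lambda + mu) ^+ k - (lambda - mu) ^+ k)
      * lambda ^+ (n - 1 - k) * harmonic_number (n - 1 - k)
  = (\sum_(0 <= k < n) (lambda + mu) ^+ k
      * (lambda ^+ (n - 1 - k) * harmonic_number (n - 1 - k)))
    - \sum_(0 <= k < n) (lambda - mu) ^+ k
      * (lambda ^+ (n - 1 - k) * harmonic_number (n - 1 - k)).
  by rewrite -sumrB; apply: eq_bigr => k _; ring.
by field.
Qed.

Theorem proposition5 (R : realType) (mu lambda : R[i]) (n : nat) (hn : (1 <= n)%N) :
  \sum_(0 <= k < n.+1)
      'C(n, k)%:R * (k %/ 2)%:R * mu ^+ k * lambda ^+ (n - k) * harmonic_number k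
  = n%:R * mu / 2 * (lambda + mu) ^+ (n - 1) * harmonic_number n
    - 1 / 4 * ((lambda + mu) ^+ n - (lambda - mu) ^+ n) * harmonic_number n
    - mu / 4 * \sum_(0 <= k < n)
        ((lambda + mu) ^+ k - (lambda - mu) ^+ k)
          * lambda ^+ (n - 1 - k) * harmonic_number (n - 1 - k)
    - mu ^+ 2 / 2 * \sum_(0 <= k < n - 1)
        (k + 1)%:R * (lambda + mu) ^+ k
          * lambda ^+ (n - 2 - k) * harmonic_number (n - 2 - k).
Proof. exact: binomial_half_harmonic_sum. Qed.
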